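(* If $G$ is a boiler, then $\chi(G)\le\lceil\frac54\omega(G)\rceil$.
   Context: A boiler is a $(P_6,C_4,C_6)$-free graph whose vertex set is partitioned into five sets $Q,A,B,L,M$ such that: $Q,A,B,M$ are non-empty and $Q,A,B$ are cliques; $Q$ is complete to $A$ and to $M$, and $B$ is complete to $L$; $Q$ is anticomplete to $B$ and to $L$, and $L$ is anticomplete to $M$; $G[L]$ and $G[M]$ are $(P_4,2P_3)$-free; every vertex of $L$ has a neighbor in $A$; for some integer $k\ge 3$, $M$ is partitioned into $k$ non-empty pairwise anticomplete sets $M_1,\dots,M_k$ and $B$ into $k$ non-empty sets $B_1,\dots,B_k$ such that for each $i$ every vertex of $M_i$ has a neighbor in $B_i$ and no neighbor in $B\setminus B_i$, and every vertex of $B$ has a neighbor in $M$; $A$ is complete to $M_1\cup B_1\cup M_2\cup B_2$, for each $i\in\{3,\dots,k\}$ every vertex of $A$ is complete or anticomplete to $M_i\cup B_i$, and no vertex of $A$ is complete to $B$. Complete/anticomplete: all edges / no edges between the sets; $2P_3$ is the disjoint union of two copies of $P_3$. *)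

(* Defs.v *)
(* Simple graphs: e : rel T on a finType T, symmetric and irreflexive. *)
From mathcomp Require Import all_boot.
Set Implicit Arguments. Unset Strict Implicit. Unset Printing Implicit Defensive.

Section Graphs.
Variable T : finType.
Variable e : rel T.

Definition complete (X Y : {set T}) : Prop :=
  forall x y, x \in X -> y \in Y -> e x y.
Definition anticomplete (X Y : {set T}) : Prop :=
  forall x y, x \in X -> y \in Y -> ~~ e x y.

Definition is_clique (S : {set T}) : bool :=
  [forall x in S, forall y in S, (x != y) ==> e x y].

Definition induced_in (n : nat) (h : rel 'I_n) (S : {set T}) : Prop :=
  exists f : 'I_n -> T, [/\ injective f, (forall i, f i \in S) &
                             (forall i j, e (f i) (f j) = h i j)].

Definition free_in (n : nat) (h : rel 'I_n) (S : {set T}) : Prop :=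
  ~ induced_in h S.

Definition free (n : nat) (h : rel 'I_n) : Prop := free_in h [set: T].

Definition colorable (k : nat) : bool :=
  [exists f : {ffun T -> 'I_k},
     [forall x, forall y, ((x != y) && e x y) ==> (f x != f y)]].

Lemma colorable_card : exists k, colorable k.
Proof.
exists #|T|; apply/existsP; exists [ffun x => enum_rank x].
apply/forallP => x; apply/forallP => y; apply/implyP => /andP [nxy _].
by rewrite !ffunE (inj_eq enum_rank_inj).
Qed.

Definition chi : nat := ex_minn colorable_card.
Definition omega : nat := \max_(S : {set T} | is_clique S) #|S|.

End Graphs.

Definition path_rel (n : nat) : rel 'I_n :=
  fun i j => ((i : nat).+1 == j) || ((j : nat).+1 == i).
Definition cycle_rel (n : nat) : rel 'I_n :=
  fun i j => path_rel i j ||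
    (((i : nat) == 0) && ((j : nat) == n.-1)) ||
    (((j : nat) == 0) && ((i : nat) == n.-1)).
(* 2P3 : paths 0-1-2 and 3-4-5 *)
Definition twoP3_rel : rel 'I_6 :=
  fun i j => path_rel i j &&
    ~~ ((((i : nat) == 2) && ((j : nat) == 3)) || (((i : nat) == 3) && ((j : nat) == 2))).

Notation P4 := (@path_rel 4).
Notation P6 := (@path_rel 6).
Notation C4 := (@cycle_rel 4).
Notation C6 := (@cycle_rel 6).
Notation P3P3 := twoP3_rel.

(* The boiler structure, as in the paper. M_1, M_2 are indices 0, 1;
   M_i for i in {3..k} are indices 2..k-1. *)
Definition boiler (T : finType) (e : rel T) : Prop :=
  exists (Q A B L M : {set T}) (k : nat) (Ms Bs : nat -> {set T}),
   [/\ free e P6, free e C4 & free e C6] /\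
   [/\ Q :|: A :|: B :|: L :|: M = [set: T],
       [/\ [disjoint Q & A], [disjoint Q & B], [disjoint Q & L] & [disjoint Q & M]],
       [/\ [disjoint A & B], [disjoint A & L] & [disjoint A & M]] &
       [/\ [disjoint B & L], [disjoint B & M] & [disjoint L & M]]] /\
   [/\ Q != set0, A != set0, B != set0 & M != set0] /\
   [/\ is_clique e Q, is_clique e A & is_clique e B] /\
   [/\ complete e Q A, complete e Q M & complete e B L] /\
   [/\ anticomplete e Q B, anticomplete e Q L & anticomplete e L M] /\
   [/\ free_in e P4 L, free_in e P3P3 L, free_in e P4 M & free_in e P3P3 M] /\
   (forall v, v \in L -> exists2 a, a \in A & e v a) /\
   [/\ 3 <= k,
       M = \bigcup_(i < k) Ms i /\ B = \bigcup_(i < k) Bs i /\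
       (forall i, i < k -> Ms i != set0 /\ Bs i != set0),
       (forall i j, i < k -> j < k -> i != j ->
          [/\ [disjoint Ms i & Ms j], [disjoint Bs i & Bs j] & anticomplete e (Ms i) (Ms j)]),
       (forall i v, i < k -> v \in Ms i ->
          (exists2 b, b \in Bs i & e v b) /\
          (forall b, b \in B :\: Bs i -> ~~ e v b)) &
       (forall b, b \in B -> exists2 m, m \in M & e b m)] /\
   [/\ complete e A (Ms 0 :|: Bs 0 :|: Ms 1 :|: Bs 1),
       (forall i a, 2 <= i < k -> a \in A ->
          complete e [set a] (Ms i :|: Bs i) \/ anticomplete e [set a] (Ms i :|: Bs i)) &
       (forall a, a \in A -> ~ complete e [set a] B)].

(* Main.v *)
(* Only C4-freeness and the P4-freeness of L and M matter. Put w = omega,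
   nu = ceil(w/4), N = w + nu. In M and in L adjacent vertices have nested closed
   neighbourhoods, so once Q, A, B are coloured, M and L can be coloured greedily,
   larger neighbourhoods first. This succeeds with N colours as soon as
   - B is rainbow, and the set R of vertices of B whose colour is repeated on Q
     meets each N_B(m) in at least min(|Q|, |N_B(m)|) - nu vertices, and
   - the set R' of vertices of A whose colour is repeated on B meets each N_A(l)
     in at least |N_A(l)| + |B| + |K(l)| - N vertices, K(l) being the clique of
     the vertices of L dominating l.
   The sets N_B(m), and likewise the sets N_A(l), form laminar families, because
   of C4-freeness. A set meeting all demands and of minimal weight is covered by
   disjoint tight sets of its family; each of these has more than nu elements, so
   there are at most three. The resulting bounds on R and R' leave enough room to
   give every vertex of R', in order of decreasing N_B, the colour of a
   non-neighbour in B \ R. *)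
Require Import Defs.
From mathcomp Require Import all_boot zify.
Set Implicit Arguments. Unset Strict Implicit. Unset Printing Implicit Defensive.

(** * Sets of least weight meeting demands on a laminar family *)

Section Laminar.
Variables (T I : finType) (A : {set T}) (F : I -> {set T}) (d : I -> nat).
Variable h : T -> nat.
Hypothesis F_sub : forall i, F i \subset A.
Hypothesis d_le : forall i, d i <= #|F i|.
Hypothesis F_laminar : forall i j x, x \in F i -> x \in F j ->
  F i \subset F j \/ F j \subset F i.

Let satisfies (R : {set T}) := (R \subset A) && [forall i, d i <= #|F i :&: R|].
Let tight (R : {set T}) i := #|F i :&: R| == d i.

(** Minimise the sum of [(h x).+1] over [R]; the successor makes every deletion a strict gain. As
    [x] cannot be deleted, it lies in a tight set; take a smallest one. If that set had a member [y]
    outside [R] with smaller [h], exchanging [x] for [y] would lower the weight: by laminarity, each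
    tight set containing [x] contains the smallest one, hence [y]. *)
Lemma exists_minimal_satisfying : exists R : {set T},
  satisfies R /\
  forall x, x \in R -> exists i, [/\ tight R i, x \in F i &
    forall y, y \in F i -> h y < h x -> y \in R].
Proof.
have satA : satisfies A.
  rewrite /satisfies subxx; apply/forallP=> i.
  by rewrite (setIidPl (F_sub i)).
case: (arg_minnP (fun R : {set T} => \sum_(x in R) (h x).+1) satA) => R satR minR.
exists R; split=> // x xR.
have /andP[RA /forallP dR] := satR.
have weightD1 : \sum_(y in R) (h y).+1 = (h x).+1 + \sum_(y in R :\ x) (h y).+1.
  rewrite (bigD1 x) //=; congr (_ + _); apply: eq_bigl => y.
  by rewrite !inE andbC.
have [i0 ti0] : exists i, tight R i && (x \in F i).
  apply/existsP/contraT; rewrite negb_exists => /forallP not_tight.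
  suff /minR : satisfies (R :\ x) by rewrite weightD1 -[X in _ <= X]add0n leq_add2r.
  apply/andP; split; first by apply: subset_trans RA; apply: subsetDl.
  apply/forallP=> i; have := dR i; have := not_tight i; rewrite /tight.
  rewrite (cardsD1 x (F i :&: R)) setIDA !inE xR.
  by case: (x \in F i); rewrite /= ?andbF ?andbT; lia.
case: (arg_minnP (P := fun i => tight R i && (x \in F i)) (fun i => #|F i|) ti0) => i /andP[ti xi] mini.
exists i; split=> // y yi hyx; apply: contraT => yR.
suff /minR : satisfies (y |: (R :\ x)).
  by rewrite weightD1 big_setU1 /= ?inE ?(negbTE yR) ?andbF // leq_add2r ltnS leqNgt hyx.
have yx : y != x by apply: contraNneq yR => ->.
apply/andP; split.
  rewrite subUset sub1set (subsetP (F_sub i) _ yi).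
  by apply: subset_trans RA; apply: subsetDl.
apply/forallP=> j; have := dR j.
have cardj : #|F j :&: (y |: (R :\ x))| + (x \in F j) = #|F j :&: R| + (y \in F j).
  have -> : F j :&: (y |: (R :\ x)) = (F j :&: [set y]) :|: (F j :&: R) :\ x.
    by apply/setP=> z; rewrite !inE; case: (z \in F j); rewrite ?andbF ?orbF.
  have disj : (F j :&: [set y]) :&: ((F j :&: R) :\ x) = set0.
    apply/setP=> z; rewrite !inE.
    by case: (z =P y) => [->|_]; rewrite ?(negbTE yR) !andbF.
  rewrite cardsU disj cards0 subn0.
  rewrite (cardsD1 x (F j :&: R)) !inE xR andbT.
  have -> : #|F j :&: [set y]| = (y \in F j).
    case yj: (y \in F j); first by rewrite (setIidPr _) ?cards1 // sub1set.
    rewrite (_ : _ :&: _ = set0) ?cards0 //; apply/setP=> z; rewrite !inE.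
    by case: eqP => [->|]; rewrite ?yj ?andbF.
  by rewrite addnC addnA addnAC.
have [xj|xj] := boolP (x \in F j); last first.
  by move: cardj; rewrite (negbTE xj) addn0 => -> dj; apply: leq_trans dj (leq_addr _ _).
have [tj|tj] := boolP (tight R j); last first.
  move: cardj; rewrite xj addn1 => cardj dj.
  by rewrite -ltnS cardj (leq_trans _ (leq_addr _ _)) // ltn_neqAle dj eq_sym tj.
have sub_ij : F i \subset F j.
  case: (F_laminar xi xj) => // sji.
  have := mini j; rewrite tj xj => /(_ isT) le_ij.
  by move: (subset_leqif_cards sji) => [_]; rewrite eqn_leq le_ij subset_leq_card // => /esym/eqP->.
by move: cardj; rewrite xj (subsetP sub_ij _ yi) !addn1 => -[->].
Qed.

(* [t] is the number of disjoint tight sets covering [R :&: U]; each of them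
   meets [R :&: U] and contains at least [nu] elements of [U] outside [R]. *)
Lemma laminar_choice : exists R : {set T},
  [/\ R \subset A, (forall i, d i <= #|F i :&: R|) &
   forall (U : {set T}) (nu Y : nat),
     (forall i x y, x \in F i -> x \in U -> y \in F i -> y \notin U -> h y < h x) ->
     (forall i, 0 < d i -> d i + nu <= #|F i|) ->
     (forall i x, 0 < d i -> x \in F i -> x \in U -> d i + nu <= Y + #|F i :\: U|) ->
     exists t, [/\ t <= #|R :&: U|, #|R :&: U| + t * nu <= #|A :&: U| &
                   #|R :&: U| + t * nu <= t * Y]].
Proof.
have [R [/andP[RA /forallP dR] Rtight]] := exists_minimal_satisfying.
exists R; split=> // U nu Y hU d_nu d_Y.
(* Outside [U] the members of a set through [x] have smaller [h], so the tight set found for [x] has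
   its whole part outside [U] in [R]. *)
pose good i x := [&& tight R i, x \in F i & F i :\: U \subset R].
have ex_good x : x \in R :&: U -> exists i, good i x.
  rewrite inE => /andP[xR xU]; have [i [ti xi dn]] := Rtight x xR.
  exists i; rewrite /good ti xi; apply/subsetP=> y; rewrite inE => /andP[yU yi].
  exact: dn yi (hU _ _ _ xi xU yi yU).
(* A largest good set for [x]; the default [set0] is never reached on [R :&: U]. *)
pose phi x := if [pick i | good i x] is Some i0
              then F [arg max_(i > i0 | good i x) #|F i|] else set0.
have phiP x : x \in R :&: U -> exists i, [/\ phi x = F i, good i x &
    forall j, good j x -> #|F j| <= #|F i|].
  move=> xRU; rewrite /phi; case: pickP => [i0 gi0|no].
    by case: arg_maxnP => // i gi maxi; exists i.
  by have [i] := ex_good x xRU; rewrite no.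
(* The set [phi x] is good for [y] as well, so laminarity and both maximalities force equality. *)
have phi_eq x y : x \in R :&: U -> y \in R :&: U -> y \in phi x -> phi y = phi x.
  move=> xRU yRU; have [i [-> gi maxi]] := phiP x xRU => yi.
  have [j [-> gj maxj]] := phiP y yRU.
  have /maxj le_ij : good i y by case/and3P: gi => ? _ ?; apply/and3P.
  have yj : y \in F j by case/and3P: gj.
  have xi : x \in F i by case/and3P: gi.
  have sij : F i \subset F j.
    case: (F_laminar yi yj) => // sji.
    by move: (subset_leqif_cards sji) => [_]; rewrite eqn_leq le_ij subset_leq_card // => /esym/eqP->.
  have /maxi le_ji : good j x.
    by case/and3P: gj => ? _ ?; apply/and3P; split=> //; apply: (subsetP sij).
  apply/eqP; rewrite eq_sym.
  by move: (subset_leqif_cards sij) => [_ <-]; rewrite eqn_leq le_ij.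
pose P := [set phi x | x in R :&: U].
pose c (X : {set T}) := \sum_(x in R :&: U | phi x == X) 1.
have card_RU : #|R :&: U| = \sum_(X in P) c X.
  by rewrite -sum1_card (partition_big_imset phi).
(* By tightness and [F i :\: U \subset R], the demand splits as [d i = c X + #|F i :\: U|]. In
   particular [0 < d i], and the two assumed bounds on [d i + nu] apply. *)
have cP X : X \in P -> [/\ 1 <= c X, c X + nu <= #|X :&: U| & c X + nu <= Y].
  case/imsetP=> x xRU ->; have [i [phix gi _]] := phiP x xRU.
  have /and3P[/eqP ti xi siU] := gi.
  have [xR xU] := setIP xRU.
  have -> : c (phi x) = #|F i :&: R :&: U|.
    rewrite /c -sum1_card; apply: eq_bigl => y; rewrite !inE.
    have [yRU|] := boolP ((y \in R) && (y \in U)); last by rewrite -andbA => /negbTE->; rewrite andbF.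
    have yRU' : y \in R :&: U by rewrite inE.
    rewrite -andbA yRU andbT /=; apply/eqP/idP => [yx|yi].
      by have [j [phiy /and3P[_ yj _] _]] := phiP y yRU'; rewrite -phix -yx phiy.
    by apply: phi_eq; rewrite ?phix.
  have di : #|F i :&: R :&: U| + #|F i :\: U| = d i.
    rewrite -ti -(cardsID U (F i :&: R)); congr (_ + _); apply: eq_card => z.
    rewrite !inE; case zi: (z \in F i); rewrite ?andbF //=; case zU: (z \in U) => //=.
    by apply/esym/(subsetP siU); rewrite !inE zU zi.
  have c_gt0 : 0 < #|F i :&: R :&: U|.
    by apply/card_gt0P; exists x; rewrite !inE xi xR.
  have d_gt0 : 0 < d i by rewrite -di addn_gt0 c_gt0.
  have := d_nu i d_gt0; have := d_Y i x d_gt0 xi xU.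
  rewrite phix -(cardsID U (F i)); split; lia.
have disj X Z y : X \in P -> Z \in P -> y \in X -> y \in Z -> y \in U -> X = Z.
  case/imsetP=> x xRU ->; case/imsetP=> z zRU -> yx yz yU.
  have [i [phix /and3P[/eqP ti xi _] _]] := phiP x xRU.
  have [j [phiz /and3P[/eqP tj zj _] _]] := phiP z zRU.
  rewrite phix in yx; rewrite phiz in yz.
  case: (F_laminar yx yz) => [sij|sji].
    by apply: phi_eq => //; rewrite phiz (subsetP sij).
  by apply/esym; apply: phi_eq => //; rewrite phix (subsetP sji).
exists #|P|; split.
- by rewrite card_RU -sum1_card; apply: leq_sum => X /cP[].
- have -> : #|R :&: U| + #|P| * nu = \sum_(X in P) (c X + nu).
    by rewrite big_split sum_nat_const card_RU.
  apply: (@leq_trans (\sum_(X in P) #|X :&: U|)).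
    by apply: leq_sum => X /cP[].
  have cardIU (X : {set T}) : #|X :&: U| = \sum_(y in U) (y \in X).
    rewrite -sum1_card (eq_bigl (fun y => (y \in U) && (y \in X))) ?big_mkcondr //.
    by move=> y; rewrite inE andbC.
  under eq_bigr => X _ do rewrite cardIU.
  (* Double counting: each point of [U] lies in at most one set of [P]. *)
  rewrite exchange_big /= cardIU; apply: leq_sum => y yU.
  have [/existsP[X /andP[XP yX]]|none] := boolP [exists X, (X \in P) && (y \in X)].
    rewrite (bigD1 X) //= yX big1 => [|Z /andP[ZP ZX]].
      case/imsetP: XP yX => x xRU ->; have [i [-> _ _]] := phiP x xRU.
      by move=> /(subsetP (F_sub i)) ->.
    by case yZ: (y \in Z) => //; rewrite (disj Z X y) ?eqxx in ZX.
  rewrite big1 // => X XP; case yX: (y \in X) => //.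
  by case/existsP: none; exists X; rewrite XP.
- rewrite card_RU -!sum_nat_const -big_split.
  by apply: leq_sum => X /cP[].
Qed.
End Laminar.

(** * Greedy list colouring, and the colouring of the three cliques *)

Section Coloring.
Variables (T : finType) (e : rel T).
Hypotheses (e_sym : symmetric e) (e_irr : irreflexive e).

Definition closed_nbhd v : {set T} := [set u | (u == v) || e v u].
Local Notation "N[ v ]" := (closed_nbhd v).

Lemma closed_nbhdC x y : (x \in N[y]) = (y \in N[x]).
Proof. by rewrite !inE eq_sym e_sym. Qed.

Definition proper_on (N : nat) (X : {set T}) (f : T -> 'I_N) : Prop :=
  forall x y, x \in X -> y \in X -> e x y -> f x <> f y.

Lemma proper_on_clique_inj N (X : {set T}) (f : T -> 'I_N) :
  is_clique e X -> proper_on X f -> {in X &, injective f}.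
Proof.
move=> /forall_inP cX pf x y xX yX fxy; apply/eqP/contraT => nxy.
case: (pf x y xX yX _ fxy).
by have /forall_inP/(_ y yX)/implyP/(_ nxy) := cX x xX.
Qed.

(** Vertices are coloured by decreasing [c], so a vertex minimising [c] comes last. Quantifying the
    room over all [Y'] lets the condition pass to [Y :\ v]. Since [v] itself counts in [Y' :&:
    N[v]], a weak inequality leaves one colour free. *)
Lemma greedy_extension N (X Y : {set T}) (f : T -> 'I_N) (C : T -> {set 'I_N})
    (c : T -> nat) :
  proper_on X f -> [disjoint X & Y] ->
  (forall (Y' : {set T}) v, Y' \subset Y -> v \in Y' ->
     (forall x, x \in Y' -> c v <= c x) ->
     #|Y' :&: N[v]| <= #|C v :\: f @: (X :&: N[v])|) ->
  exists g : T -> 'I_N, [/\ proper_on (X :|: Y) g,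
     forall x, x \in X -> g x = f x & forall y, y \in Y -> g y \in C y].
Proof.
move=> pf; move: {2}#|Y| (leqnn #|Y|) => n; elim: n Y => [|n IHn] Y.
  rewrite leqn0 cards_eq0 => /eqP-> _ _; exists f; split=> [|//|y]; last by rewrite inE.
  by rewrite setU0.
move=> leY dXY room.
have [->|/set0Pn[v0 v0Y]] := eqVneq Y set0.
  by apply: IHn; rewrite ?cards0 ?disjoints1 // -?setI_eq0 ?setI0 // => Y' v; rewrite subset0 => /eqP->; rewrite inE.
case: (arg_minnP c v0Y) => v vY min_v; have {}vY : v \in Y := vY.
have sub1 : Y :\ v \subset Y by apply: subsetDl.
have [|||g [pg gX gC]] := IHn (Y :\ v).
- by rewrite -ltnS (leq_trans _ leY) // [X in _ < X](cardsD1 v) vY.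
- exact: disjointWr sub1 dXY.
- by move=> Y' w sY'; apply: room; apply: subset_trans sub1.
have vX : v \notin X by rewrite (disjointFl dXY).
have [col] : exists col, col \in (C v :\: f @: (X :&: N[v])) :\: g @: ((Y :\ v) :&: N[v]).
  apply/set0Pn; rewrite -card_gt0 cardsD subn_gt0.
  apply: leq_ltn_trans (subset_leq_card (subsetIr _ _)) _.
  apply: leq_ltn_trans (leq_imset_card _ _) _.
  apply: leq_trans (room Y v (subxx _) vY min_v).
  apply: proper_card; apply/properP; split; first by apply: setSI.
  by exists v; rewrite !inE eqxx ?vY.
rewrite !inE => /andP[colY /andP[colX colC]].
have colP x : x \in X :|: Y -> e v x -> g x <> col.
  move=> xXY evx; have xv : x != v by apply: contraTneq evx => ->; rewrite e_irr.
  move=> gx; case/setUP: xXY => [xX|xY].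
    by case/negP: colX; apply/imsetP; exists x; rewrite ?inE ?xX ?evx ?orbT // -gX.
  by case/negP: colY; apply/imsetP; exists x; rewrite // !inE xv xY evx orbT.
exists (fun x => if x == v then col else g x); split=> [x y|x xX|y yY].
- move=> xXY yXY exy; case: eqP => [xv|/eqP xv]; case: eqP => [yv|/eqP yv].
  + by rewrite xv yv e_irr in exy.
  + by move/esym; apply: colP; rewrite -?xv.
  + by apply: colP; rewrite -?yv // e_sym.
  + by apply: pg => //; [move: xXY | move: yXY]; rewrite !inE ?xv ?yv.
- by case: eqP xX vX => [-> ->|_ /gX].
- by case: eqP => [->|/eqP yv] //; apply: gC; rewrite !inE yv.
Qed.

Lemma clique_subset_leq_card (Y Y' : {set T}) v (n : nat) :
  Y' \subset Y -> #|Y| <= n -> #|Y' :&: N[v]| <= n.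
Proof.
move=> sY'; apply: leq_trans; apply: subset_leq_card.
by apply: subset_trans sY'; apply: subsetIl.
Qed.

(** The order is [B], [R'], the rest of [A], then [Q]. The last hypothesis is the room for [R']:
    when [a] is coloured, only vertices of [R'] with at least as many neighbours in [B] have been
    coloured, and [a] wants the colour of a non-neighbour in [B :\: R]. *)
Lemma skeleton_coloring N (Q A B R R' : {set T}) :
  0 < N -> is_clique e Q -> is_clique e A -> is_clique e B ->
  anticomplete e Q B ->
  [disjoint Q & A] -> [disjoint Q & B] -> [disjoint A & B] ->
  R \subset B -> R' \subset A ->
  #|R| <= #|Q| -> #|Q| + #|A| <= N -> #|A| + #|B| <= N + #|R'| ->
  (forall a, a \in R' ->
     #|[set x in R' | #|B :&: N[a]| <= #|B :&: N[x]|]| + #|R :&: (B :\: N[a])|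
       <= #|B :\: N[a]|) ->
  exists f : T -> 'I_N, [/\ proper_on (Q :|: A :|: B) f,
     f @: R \subset f @: Q & f @: R' \subset f @: B].
Proof.
move=> N_gt0 cQ cA cB aQB dQA dQB dAB sR sR' leRQ leQA leAB room.
have leR' : #|R'| <= #|A| by apply: subset_leq_card.
have leB : #|B| <= N.
  by rewrite -(leq_add2l #|A|) (leq_trans leAB) // addnC leq_add2r.
pose f0 (x : T) := Ordinal N_gt0.
have [|||f1 [pf1 _ _]] := @greedy_extension N set0 B f0 (fun=> setT) (fun=> 0).
- by move=> x y; rewrite inE.
- by rewrite -setI_eq0 set0I.
- move=> Y' v sY' _ _; rewrite set0I imset0 setD0 cardsT card_ord.
  exact: clique_subset_leq_card sY' leB.
rewrite set0U in pf1.
have inj1 := proper_on_clique_inj cB pf1.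
have [||f2 [pf2 f2B f2R']] := @greedy_extension N B R' f1
    (fun=> f1 @: (B :\: R)) (fun x => #|B :&: N[x]|) pf1.
- by apply: disjointWr sR' _; rewrite disjoint_sym.
- move=> Y' v sY' vY' min_v.
  have vR' := subsetP sY' v vY'.
  apply: (@leq_trans #|f1 @: (B :\: N[v] :\: R)|).
    rewrite card_in_imset; last first.
      by apply: (sub_in2 _ inj1) => x; rewrite !inE => /and3P[].
    rewrite cardsD [_ :&: R]setIC leq_subRL.
      rewrite addnC; apply: leq_trans (room v vR'); rewrite leq_add2r.
      apply: subset_leq_card; apply/subsetP=> x /setIP[xY' _].
      by rewrite inE (subsetP sY') // min_v.
    by apply: leq_trans (room v vR'); apply: leq_addl.
  apply: subset_leq_card; apply/subsetP=> _ /imsetP[x xD ->].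
  move: xD; rewrite 2!inE => /and3P[xR xv xB]; rewrite inE; apply/andP; split.
    apply/imsetP=> -[y /setIP[yB yv] /inj1 xy].
    by rewrite xy ?yv // in xv.
  by apply/imsetP; exists x; rewrite ?inE ?xR.
have f2B_im : f2 @: B = f1 @: B by apply: eq_in_imset => x /f2B.
have f2R'_sub : f2 @: R' \subset f2 @: B.
  apply/subsetP=> _ /imsetP[x /f2R' /imsetP[y yB ->] ->]; rewrite f2B_im.
  by apply: imset_f; case/setDP: yB.
have inj2 : {in B &, injective f2} by move=> x y xB yB; rewrite !f2B //; apply: inj1.
have card_f2B : #|f2 @: B| = #|B| by rewrite card_in_imset.
(* The rest of [A] avoids the colours of [B], hence also those of [R']; the bound on [#|A| + #|B|]
   leaves enough of them. *)
have [||f3 [pf3 f3BR' f3A]] := @greedy_extension N (B :|: R') (A :\: R') f2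
    (fun=> ~: f2 @: B) (fun=> 0) pf2.
- rewrite disjoint_sym -setI_eq0; apply/eqP/setP=> x; rewrite !inE.
  case xR': (x \in R'); rewrite //= orbF andbC.
  by have [xA|xA] := boolP (x \in A); rewrite ?andbF // (disjointFr dAB).
- move=> Y' v sY' _ _.
  apply: clique_subset_leq_card sY' _.
  have -> : ~: f2 @: B :\: f2 @: ((B :|: R') :&: N[v]) = ~: f2 @: B.
    apply/setDidPl; rewrite disjoint_sym disjoints_subset setCK.
    apply: subset_trans (imsetS _ (subsetIl _ _)) _.
    by rewrite imsetU subUset subxx.
  rewrite [#|~: _|]cardsCs setCK card_ord card_f2B cardsD (setIidPr sR').
  by rewrite leq_subRL // addnBA // leq_subLR addnC [#|R'| + N]addnC.
have eqBA : B :|: R' :|: A :\: R' = A :|: B.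
  rewrite -setUA setUC; congr (_ :|: _); apply/setP=> x; rewrite !inE.
  by case xR': (x \in R') => //=; rewrite (subsetP sR').
rewrite eqBA in pf3.
have f3B : {in B, f3 =1 f2} by move=> x xB; apply: f3BR'; rewrite inE xB.
have f3R' : {in R', f3 =1 f2} by move=> x xB; apply: f3BR'; rewrite inE xB orbT.
(* [R'] repeats only colours of [B :\: R], and the rest of [A] none of [B], so the colours of [R]
   remain available to [Q]. *)
have dRA : [disjoint f3 @: R & f3 @: A].
  rewrite -setI_eq0; apply/eqP/setP=> z; rewrite [RHS]inE; apply/negbTE/negP.
  case/setIP=> /imsetP[r rR ->] /imsetP[a aA].
  have rB := subsetP sR r rR; rewrite f3B //.
  have [aR'|aR'] := boolP (a \in R').
    rewrite f3R' // f2B // => f_eq; have := f2R' a aR'; rewrite -f_eq.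
    case/imsetP=> b /setDP[bB bR] /inj1 rb.
    by rewrite -rb ?rR // in bR.
  move=> f_eq; have := f3A a; rewrite -f_eq inE aR' aA => /(_ isT).
  by rewrite inE imset_f.
have le_fR : #|f3 @: R| <= #|Q| by apply: leq_trans leRQ; apply: leq_imset_card.
have leZ : #|Q| - #|f3 @: R| <= #|~: (f3 @: A :|: f3 @: R)|.
  rewrite [#|~: _|]cardsCs setCK card_ord.
  move: (leq_card_setU (f3 @: A) (f3 @: R)).1 (leq_imset_card f3 A) leQA; clear; lia.
have [s [s_uniq s_size s_sub]] := card_geqP leZ.
(* The palette of [Q]: the colours of [R], padded to exactly [#|Q|] colours avoiding [A]. Colours of
   [B] are allowed, as [Q] is anticomplete to [B]. A rainbow colouring of [Q] then uses all of [Z],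
   in particular the colours of [R]. *)
pose Z := f3 @: R :|: [set z in s].
have cardZ : #|Z| = #|Q|.
  rewrite /Z cardsU disjoint_setI0 ?cards0 ?subn0; last first.
    rewrite disjoint_sym disjoints_subset; apply/subsetP=> z; rewrite !inE => /s_sub.
    by rewrite !inE negb_or => /andP[].
  by rewrite cardsE (card_uniqP s_uniq) s_size subnKC.
have dZA : [disjoint Z & f3 @: A].
  rewrite disjoints_subset subUset -disjoints_subset dRA.
  by apply/subsetP=> z; rewrite !inE => /s_sub; rewrite !inE negb_or => /andP[].
have [||f [pf fAB fQ]] := @greedy_extension N (A :|: B) Q f3 (fun=> Z) (fun=> 0) pf3.
- by rewrite -setI_eq0 setIUl setU_eq0 !setI_eq0 ![[disjoint _ & Q]]disjoint_sym dQA.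
- move=> Y' v sY' vY' _; have vQ := subsetP sY' v vY'.
  apply: clique_subset_leq_card sY' _.
  rewrite -cardZ; apply: subset_leq_card; apply/subsetP=> z zZ.
  rewrite inE zZ andbT; apply/imsetP=> -[x /setIP[xAB xv] zx].
  case/setUP: xAB => [xA|xB].
    by move: (disjointFr dZA zZ); rewrite zx imset_f.
  move: xv; rewrite inE (negbTE (aQB v x vQ xB)) orbF => /eqP xv.
  by rewrite xv (disjointFr dQB vQ) in xB.
rewrite setUC setUA in pf.
have pfQ : proper_on Q f by move=> x y xQ yQ; apply: pf; rewrite !inE ?xQ ?yQ.
have fQZ : f @: Q = Z.
  apply/eqP; rewrite eqEcard cardZ card_in_imset ?leqnn ?andbT; last first.
    exact: proper_on_clique_inj pfQ.
  by apply/subsetP=> _ /imsetP[x xQ ->]; apply: fQ.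
have fA : {in A, f =1 f3} by move=> x xA; apply: fAB; rewrite inE xA.
have fB : {in B, f =1 f3} by move=> x xB; apply: fAB; rewrite inE xB orbT.
exists f; split=> //.
  rewrite fQZ (_ : f @: R = f3 @: R) ?subsetUl //.
  by apply: eq_in_imset => x /(subsetP sR)/fB.
rewrite (_ : f @: R' = f2 @: R') 1?(_ : f @: B = f2 @: B) //.
  by apply: eq_in_imset => x xB; rewrite fB ?f3B.
by apply: eq_in_imset => x xR'; rewrite fA ?f3R' ?(subsetP sR').
Qed.
End Coloring.

(** * Cliques and bounds on [omega] and [chi] *)

Section Cliques.
Variables (T : finType) (e : rel T).
Local Notation "N[ v ]" := (closed_nbhd e v).

Lemma is_cliqueP (S : {set T}) :
  reflect (forall x y, x \in S -> y \in S -> y \in N[x]) (is_clique e S).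
Proof.
apply: (iffP forall_inP) => [cS x y xS yS|cS x xS].
  have := forall_inP (cS x xS) y yS; rewrite inE eq_sym.
  by case: eqP => //= _ /implyP ->.
apply/forall_inP=> y yS; apply/implyP; rewrite eq_sym => nxy.
by have := cS x y xS yS; rewrite inE (negbTE nxy).
Qed.

Hypothesis e_sym : symmetric e.

Lemma is_cliqueU (X Y : {set T}) :
  is_clique e X -> is_clique e Y -> complete e X Y -> is_clique e (X :|: Y).
Proof.
move=> /is_cliqueP cX /is_cliqueP cY cXY; apply/is_cliqueP=> x y.
case/setUP=> xS; case/setUP=> yS; [exact: cX | | | exact: cY].
  by rewrite inE cXY ?orbT.
by rewrite inE e_sym cXY ?orbT.
Qed.

Lemma clique_sub (X Y : {set T}) : X \subset Y -> is_clique e Y -> is_clique e X.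
Proof.
by move=> sXY /is_cliqueP cY; apply/is_cliqueP=> x y xX yX; apply: cY; apply: (subsetP sXY).
Qed.

Lemma clique2_leq_omega (X Y : {set T}) : is_clique e X -> is_clique e Y ->
  [disjoint X & Y] -> complete e X Y -> #|X| + #|Y| <= omega e.
Proof.
move=> cX cY dXY cXY; rewrite -(leq_card_setU X Y).2 in dXY.
by rewrite -(eqP dXY); apply: leq_bigmax_cond; apply: is_cliqueU.
Qed.

Lemma clique3_leq_omega (X Y Z : {set T}) :
  is_clique e X -> is_clique e Y -> is_clique e Z ->
  [disjoint X & Y] -> [disjoint X & Z] -> [disjoint Y & Z] ->
  complete e X Y -> complete e X Z -> complete e Y Z ->
  #|X| + #|Y| + #|Z| <= omega e.
Proof.
move=> cX cY cZ dXY dXZ dYZ cXY cXZ cYZ.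
have /eqP <- : #|X :|: Y| == #|X| + #|Y| by rewrite (leq_card_setU X Y).2.
apply: clique2_leq_omega => //; first exact: is_cliqueU.
  by rewrite -setI_eq0 setIUl setU_eq0 !setI_eq0 dXZ.
by move=> x z /setUP[xX|xY] zZ; [apply: cXZ | apply: cYZ].
Qed.

Lemma chi_leq N (f : T -> 'I_N) : proper_on e [set: T] f -> chi e <= N.
Proof.
move=> pf; rewrite /chi; case: ex_minnP => k _; apply.
apply/existsP; exists [ffun x => f x]; apply/forallP=> x; apply/forallP=> y.
by apply/implyP=> /andP[_ exy]; rewrite !ffunE; apply/eqP; apply: pf; rewrite ?inE.
Qed.
End Cliques.

(** * Arithmetic of the counts of tight sets *)

Lemma leq_4divn n : n <= 4 * ((n + 3) %/ 4).
Proof. lia. Qed.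

Lemma laminar_count_lt4 (nu b r t : nat) :
  b <= 4 * nu -> t <= r -> r + t * nu <= b -> t < 4.
Proof.
move=> leb tr rb; rewrite ltnNge; apply/negP=> t4.
by have := leq_mul t4 (leqnn nu); lia.
Qed.

(** Adding [t] times [r <= (4 - t) * nu] and [4 - t] times [r <= t * (q - nu)] gives
    [4 * r <= t * (4 - t) * q <= 4 * q]. *)
Lemma laminar_total_leq (nu q b r t : nat) :
  b <= 4 * nu -> t <= r -> r + t * nu <= b -> r + t * nu <= t * q -> r <= q.
Proof.
move=> leb tr rb rq; have := laminar_count_lt4 leb tr rb.
by case: t tr rb rq => [|[|[|[|t]]]]; lia.
Qed.

(** If [t] or [t'] is zero, only one count remains. Otherwise [q] is at least [nu + r / t], so [r']
    is at most [(3 - t') * nu - r / t]; with [r <= w - t * nu] this suffices unless [t = t' = 1]. In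
    that case [r' + r] is at most [2 * nu] and at most [2 * (w - nu)], whose mean is [w]. *)
Lemma laminar_room_leq (nu q a w r t r' t' : nat) :
  q + a <= 4 * nu -> w <= 4 * nu ->
  t <= r -> r + t * nu <= w -> r + t * nu <= t * q ->
  t' <= r' -> r' + t' * nu <= a -> r' + t' * nu <= t' * w -> r' + r <= w.
Proof.
move=> leqa lew tr rw rq tr' ra rw'.
have t4 := laminar_count_lt4 lew tr rw.
have t'4 := laminar_count_lt4 (leq_trans (leq_addl q a) leqa) tr' ra.
case: t tr rw rq t4 => [|[|[|[|t]]]] //;
  by case: t' tr' ra rw' t'4 => [|[|[|[|t']]]] //; lia.
Qed.

(** * The colouring, from privacy and nestedness of neighbourhoods *)

Section BoilerColoring.
Variables (T : finType) (e : rel T).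
Hypotheses (e_sym : symmetric e) (e_irr : irreflexive e).
Local Notation "N[ v ]" := (closed_nbhd e v).

Variables Q A B L M : {set T}.
Hypothesis cover : Q :|: A :|: B :|: L :|: M = [set: T].
Hypotheses (dQA : [disjoint Q & A]) (dQB : [disjoint Q & B])
  (dQL : [disjoint Q & L]) (dQM : [disjoint Q & M])
  (dAB : [disjoint A & B]) (dAL : [disjoint A & L]) (dAM : [disjoint A & M])
  (dBL : [disjoint B & L]) (dBM : [disjoint B & M]) (dLM : [disjoint L & M]).
Hypothesis Q_neq0 : Q != set0.
Hypotheses (cQ : is_clique e Q) (cA : is_clique e A) (cB : is_clique e B).
Hypotheses (QA : complete e Q A) (QM : complete e Q M) (BL : complete e B L).
Hypotheses (QB : anticomplete e Q B) (QL : anticomplete e Q L)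
  (LM : anticomplete e L M).
Hypothesis AB_chain : forall a a', a \in A -> a' \in A ->
  B :&: N[a] \subset N[a'] \/ B :&: N[a'] \subset N[a].
Hypothesis M_private : forall m m' b, m \in M -> m' \in M -> b \in B ->
  e m b -> e m' b -> m' \in N[m].
Hypothesis M_nested : forall m m', m \in M -> m' \in M -> m' \in N[m] ->
  N[m] \subset N[m'] \/ N[m'] \subset N[m].
Hypothesis L_private : forall l l' a, l \in L -> l' \in L -> a \in A ->
  e l a -> e l' a -> l' \in N[l].
Hypothesis L_nested : forall l l', l \in L -> l' \in L -> l' \in N[l] ->
  N[l] \subset N[l'] \/ N[l'] \subset N[l].
Hypothesis AMB : forall a m b, a \in A -> m \in M -> b \in B ->
  e m b -> e a m = e a b.

Let w := omega e.
Let nu := (w + 3) %/ 4.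
Let N := w + nu.
Let W a := B :\: N[a].

(** Used when [v] is coloured last in [Y']: its neighbours there dominate it, so they form a clique,
    complete to the other neighbours of [v]. *)
Lemma nbhd_sub_min (Y' : {set T}) (P : T -> Prop) v :
  (forall x y, P x -> P y -> y \in N[x] -> N[x] \subset N[y] \/ N[y] \subset N[x]) ->
  (forall x, x \in Y' -> P x) -> v \in Y' ->
  (forall x, x \in Y' -> #|N[v]| <= #|N[x]|) ->
  forall x, x \in Y' :&: N[v] -> N[v] \subset N[x].
Proof.
move=> nested YP vY min_v x /setIP[xY xv].
case: (nested v x (YP v vY) (YP x xY) xv) => // sxv.
have /eqP <- // : N[x] == N[v].
by rewrite eqEcard sxv min_v.
Qed.

Lemma dominating_clique (K : {set T}) v :
  (forall x, x \in K -> x \in N[v]) -> (forall x, x \in K -> N[v] \subset N[x]) ->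
  is_clique e K.
Proof. by move=> Kv sK; apply/is_cliqueP=> x y xK yK; apply: (subsetP (sK x xK)); apply: Kv. Qed.

Lemma dominating_complete (K Z : {set T}) v : [disjoint K & Z] ->
  (forall x, x \in K -> N[v] \subset N[x]) -> Z \subset N[v] -> complete e K Z.
Proof.
move=> dKZ sK sZ x z xK zZ; have := subsetP (sK x xK) z (subsetP sZ z zZ).
by rewrite inE => /orP[/eqP zx|//]; rewrite -zx (disjointFl dKZ zZ) in xK.
Qed.

Let K l : {set T} := if l \in L then [set x in L | (x \in N[l]) && (N[l] \subset N[x])] else set0.
Let FA l := if l \in L then A :&: N[l] else A.
(* An [l] outside [L] imposes the demand [#|A| + #|B| - N] on all of [A], which
   makes the colours of [A :\: R'] and [B] fit in [N]. *)
Let dA l := #|FA l| + #|B| + #|K l| - N.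
Let FB m := if m \in M then B :&: N[m] else set0.
Let dB m := minn #|Q| #|FB m| - nu.

Lemma w_leq : w <= 4 * nu. Proof. exact: leq_4divn. Qed.

Lemma K_in_L l x : x \in K l -> [/\ l \in L, x \in L, x \in N[l] & N[l] \subset N[x]].
Proof. by rewrite /K; case: ifP => lL; rewrite inE // => /and3P[]. Qed.

Lemma K_clique l : is_clique e (K l).
Proof. by apply: (@dominating_clique _ l) => x /K_in_L[]. Qed.

Lemma B_K_leq l : #|B| + #|K l| <= w.
Proof.
apply: clique2_leq_omega => //; first exact: K_clique.
  by apply: disjointWr dBL; apply/subsetP=> x /K_in_L[].
by move=> b x bB /K_in_L[_ xL _ _]; apply: BL.
Qed.

(** The weight [#|B :&: N[x]|] makes [R'] prefer vertices with many non-neighbours in [B]. For a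
    given [a], [laminar_choice] is applied with [U] the vertices having at least as many neighbours
    in [B] as [a], and [Y] equal to [#|W a|]. *)
Lemma exists_A_demand : exists R' : {set T},
  [/\ R' \subset A, (forall l, dA l <= #|FA l :&: R'|) &
   forall a, a \in R' -> exists t,
     [/\ t <= #|[set x in R' | #|B :&: N[a]| <= #|B :&: N[x]|]|,
         #|[set x in R' | #|B :&: N[a]| <= #|B :&: N[x]|]| + t * nu <= #|A| &
         #|[set x in R' | #|B :&: N[a]| <= #|B :&: N[x]|]| + t * nu <= t * #|W a|]].
Proof.
have FA_sub l : FA l \subset A by rewrite /FA; case: ifP; rewrite ?subsetIl.
have [||R' [sR' dR' bR']] := @laminar_choice T T A FA dA (fun x => #|B :&: N[x]|) FA_sub.
- move=> l; rewrite /dA /N; move: (B_K_leq l); clear; lia.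
- move=> l l' x; rewrite /FA.
  case: ifP => lL; case: ifP => l'L; rewrite ?subsetIl; try by [left|right].
  move=> /setIP[xA xl] /setIP[_ xl'].
  have adj k : k \in L -> x \in N[k] -> e k x.
    by move=> kL; rewrite inE => /orP[/eqP xk|//]; rewrite xk (disjointFl dAL kL) in xA.
  case: (L_nested lL l'L (L_private lL l'L xA (adj l lL xl) (adj l' l'L xl'))) => s.
    by left; apply: setIS.
  by right; apply: setIS.
exists R'; split=> // a aR'.
have aA := subsetP sR' a aR'.
pose U := [set x | #|B :&: N[a]| <= #|B :&: N[x]|].
have -> : [set x in R' | #|B :&: N[a]| <= #|B :&: N[x]|] = R' :&: U.
  by apply/setP=> x; rewrite !inE.
have [|||t [t1 t2 t3]] := bR' U nu #|W a|.
- by move=> l x y _; rewrite !inE -ltnNge => xU _ yU; apply: leq_trans yU xU.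
- move=> l; rewrite /dA /N; move: (B_K_leq l); clear; lia.
- move=> l x0 + _ _; rewrite /dA /N.
  (* A positive [dA l] satisfies [dA l + nu = #|FA l| + #|B| + #|K l| - w]; splitting [FA l] along
     [U] and [B] along [N[a]] reduces the bound to the size of a clique. It is a clique because, by
     [AB_chain], each [x] in [U] sees all of [B :&: N[a]]. *)
  suff : #|FA l :&: U| + #|B :&: N[a]| + #|K l| <= w.
    have := cardsID U (FA l); have := cardsID N[a] B; rewrite -/(W a).
    by clear; lia.
  have FU_A : FA l :&: U \subset A by apply: subset_trans (FA_sub l); apply: subsetIl.
  apply: clique3_leq_omega => //.
  + exact: clique_sub FU_A cA.
  + exact: clique_sub (subsetIl _ _) cB.
  + exact: K_clique.
  + by apply: disjointWl FU_A _; apply: disjointWr (subsetIl _ _) _.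
  + by apply: disjointWl FU_A _; apply: disjointWr dAL; apply/subsetP=> x /K_in_L[].
  + by apply: disjointWl (subsetIl _ _) _; apply: disjointWr dBL; apply/subsetP=> x /K_in_L[].
  + move=> x b xFU bBa.
    have xA := subsetP FU_A x xFU; have [bB ba] := setIP bBa.
    have bx : b \in N[x].
      have le_ax : #|B :&: N[a]| <= #|B :&: N[x]|.
        by case/setIP: xFU => _; rewrite inE.
      case: (AB_chain aA xA) => [s|s]; first exact: (subsetP s).
      suff : B :&: N[x] == B :&: N[a] by move/eqP=> E; move: bBa; rewrite -E => /setIP[].
      by rewrite eqEcard le_ax andbT subsetI subsetIl.
    by move: bx; rewrite inE => /orP[/eqP bx|//]; rewrite -bx (disjointFl dAB bB) in xA.
  + move=> x y xFU yK; have [lL yL yl s] := K_in_L yK.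
    have xA := subsetP FU_A x xFU.
    have /(subsetP s) : x \in N[l] by move: xFU; rewrite /FA lL => /setIP[/setIP[]].
    rewrite inE => /orP[/eqP xy|]; last by rewrite e_sym.
    by rewrite xy (disjointFl dAL yL) in xA.
  + by move=> b x /setIP[bB _] /K_in_L[_ xL _ _]; apply: BL.
exists t; split=> //; apply: leq_trans t2 _.
by apply: subset_leq_card; apply: subsetIl.
Qed.

(** With constant weight, [laminar_choice] applies only to a [U] that contains or misses each
    [FB m]. This is clear for [B], which gives [#|R| <= #|Q|], and for [W a] it follows from
    [AMB]. *)
Lemma exists_B_demand : exists R : {set T},
  [/\ R \subset B, (forall m, dB m <= #|FB m :&: R|), #|R| <= #|Q| &
   forall a, a \in A -> exists t,
     [/\ t <= #|R :&: W a|, #|R :&: W a| + t * nu <= #|W a| &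
         #|R :&: W a| + t * nu <= t * #|Q|]].
Proof.
have FB_sub m : FB m \subset B by rewrite /FB; case: ifP; rewrite ?subsetIl ?sub0set.
have FB_mem m x : x \in FB m -> [/\ m \in M, x \in B & e m x].
  rewrite /FB; case: ifP => mM; rewrite inE // => /andP[xB].
  by rewrite inE => /orP[/eqP xm|//]; rewrite -xm (disjointFr dBM xB) in mM.
have [||R [sR dR bR]] := @laminar_choice T T B FB dB (fun=> 0) FB_sub.
- move=> m; rewrite /dB; clear; lia.
- move=> m m' x /FB_mem[mM xB emx] /FB_mem[m'M _ em'x]; rewrite /FB mM m'M.
  case: (M_nested mM m'M (M_private mM m'M xB emx em'x)) => s.
    by left; apply: setIS.
  by right; apply: setIS.
exists R; split=> //.
  have [|||t [t1 t2 t3]] := bR B nu #|Q|.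
  - by move=> m x y _ _ /(subsetP (FB_sub m)) ->.
  - move=> m; rewrite /dB; clear; lia.
  - move=> m x; rewrite /dB; clear; lia.
  rewrite (setIidPl sR) setIid in t1 t2 t3.
  apply: laminar_total_leq t1 t2 t3; apply: leq_trans w_leq.
  by apply: leq_bigmax_cond.
move=> a aA; have [|||t [t1 t2 t3]] := bR (W a) nu #|Q|.
- move=> m x y /FB_mem[mM xB emx] /setDP[_ xa] /FB_mem[_ yB emy].
  rewrite in_setD yB andbT negbK inE => /orP[/eqP ya|eay].
    by rewrite -ya (disjointFl dAB yB) in aA.
  by case/negP: xa; rewrite inE -(AMB aA mM xB emx) (AMB aA mM yB emy) eay orbT.
- move=> m; rewrite /dB; clear; lia.
- move=> m x; rewrite /dB; clear; lia.
exists t; split=> //; apply: leq_trans t2 _.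
by apply: subset_leq_card; apply: subsetIr.
Qed.

Lemma boiler_coloring : chi e <= N.
Proof.
have [R' [sR' dR' bR']] := exists_A_demand.
have [R [sR dR leRQ bR]] := exists_B_demand.
have leQA : #|Q| + #|A| <= w by apply: clique2_leq_omega.
have leBw : #|B| <= w by apply: leq_bigmax_cond.
have [q0 q0Q] := set0Pn _ Q_neq0.
have N_gt0 : 0 < N.
  rewrite /N addn_gt0 (leq_trans _ leQA) // addn_gt0 card_gt0.
  by rewrite Q_neq0.
have leAB : #|A| + #|B| <= N + #|R'|.
  (* The vertex [q0] lies outside [L], so its demand is the one on all of [A]. *)
  have := dR' q0; rewrite /dA /FA /K (disjointFr dQL q0Q) cards0 addn0.
  by rewrite (setIidPr sR') leq_subLR.
have [|a aR'|f [pf fR fR']] := @skeleton_coloring T e e_sym e_irr N Q A B R R'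
  N_gt0 cQ cA cB QB dQA dQB dAB sR sR' leRQ _ leAB.
- by apply: leq_trans leQA _; apply: leq_addr.
- have [t [t1 t2 t3]] := bR a (subsetP sR' a aR').
  have [t' [t1' t2' t3']] := bR' a aR'.
  apply: laminar_room_leq t1 t2 t3 t1' t2' t3'.
    by apply: leq_trans leQA w_leq.
  apply: leq_trans w_leq; apply: leq_trans leBw.
  by apply: subset_leq_card; apply: subsetDl.
have adjX (X Y : {set T}) x y : [disjoint X & Y] -> x \in X -> y \in Y -> y \in N[x] -> e x y.
  move=> dXY xX yY; rewrite inE => /orP[/eqP yx|//].
  by rewrite -yx (disjointFl dXY yY) in xX.
have [||g [pg gX _]] := @greedy_extension T e e_sym e_irr N (Q :|: A :|: B) M f
    (fun=> setT) (fun x => #|N[x]|) pf.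
- by rewrite -setI_eq0 !setIUl !setU_eq0 !setI_eq0 dQM dAM dBM.
- move=> Y' v sY' vY' min_v; have vM := subsetP sY' v vY'.
  have := nbhd_sub_min M_nested (subsetP sY') vY' min_v.
  set K' := Y' :&: N[v] => domK.
  have sKM : K' \subset M by apply: subset_trans sY'; apply: subsetIl.
  have cK : is_clique e K' by apply: dominating_clique domK => x /setIP[].
  pose Av := A :&: N[v]; pose Bv := B :&: N[v].
  have dAvK : [disjoint Av & K'] by apply: disjointWl (subsetIl _ _) _; apply: disjointWr sKM _.
  have dBvK : [disjoint Bv & K'] by apply: disjointWl (subsetIl _ _) _; apply: disjointWr sKM _.
  have KAv : complete e K' Av.
    by apply: dominating_complete domK (subsetIr _ _); rewrite disjoint_sym.
  have KBv : complete e K' Bv.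
    by apply: dominating_complete domK (subsetIr _ _); rewrite disjoint_sym.
  have cAv : is_clique e Av by apply: clique_sub (subsetIl _ _) cA.
  have leQAK : #|Q| + #|Av| + #|K'| <= w.
    apply: clique3_leq_omega => //.
    + by apply: disjointWr (subsetIl _ _) _.
    + by apply: disjointWr sKM _.
    + by move=> q a qQ /setIP[aA _]; apply: QA.
    + by move=> q m qQ /(subsetP sKM); apply: QM.
    + by move=> a m aA mK; rewrite e_sym; apply: KAv.
  have leABK : #|Av| + #|Bv| + #|K'| <= w.
    apply: clique3_leq_omega => //.
    + by apply: clique_sub (subsetIl _ _) cB.
    + by apply: disjointWl (subsetIl _ _) _; apply: disjointWr (subsetIl _ _) _.
    + move=> a b /setIP[aA av] /setIP[bB bv].
      rewrite -(AMB aA vM bB); last by apply: (adjX M B) => //; rewrite disjoint_sym.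
      by apply: (adjX A M) => //; rewrite closed_nbhdC.
    + by move=> a m aA mK; rewrite e_sym; apply: KAv.
    + by move=> b m bB mK; rewrite e_sym; apply: KBv.
  have demand : minn #|Q| #|Bv| - nu <= #|Bv :&: R|.
    by have := dR v; rewrite /dB /FB vM.
  have := cardsID R Bv => card_Bv.
  (* Colours of [R] already occur on [Q], so only [Bv :\: R] adds new ones. *)
  have forbidden : #|f @: ((Q :|: A :|: B) :&: N[v])| <= #|Q| + #|Av| + #|Bv :\: R|.
    apply: (@leq_trans #|f @: Q :|: f @: Av :|: f @: (Bv :\: R)|).
      apply: subset_leq_card; apply/subsetP=> _ /imsetP[x /setIP[xX xv] ->].
      case/setUP: xX => [/setUP[xQ|xA]|xB]; rewrite 2!in_setU.
      - by rewrite imset_f.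
      - have -> : f x \in f @: Av by apply: imset_f; rewrite in_setI xA.
        by rewrite orbT.
      have [xR|xR] := boolP (x \in R).
        by rewrite (subsetP fR) // imset_f.
      have -> : f x \in f @: (Bv :\: R) by apply: imset_f; rewrite in_setD xR in_setI xB.
      by rewrite orbT.
    apply: leq_trans (leq_card_setU _ _).1 _; apply: leq_add (leq_imset_card _ _).
    apply: leq_trans (leq_card_setU _ _).1 _.
    by apply: leq_add; apply: leq_imset_card.
  rewrite cardsD setTI cardsT card_ord leq_subRL.
    apply: leq_trans (leq_add forbidden (leqnn _)) _.
    (* The two cliques bound [#|Av| + #|K'|] plus the larger of [#|Q|] and [#|Bv|] by [w]; the
       demand pays for the smaller one, up to [nu]. *)
    move: leQAK leABK demand card_Bv; rewrite /N; clear; lia.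
  by rewrite -[X in _ <= X]card_ord max_card.
have fg_im (S : {set T}) : S \subset Q :|: A :|: B -> g @: S = f @: S.
  by move=> sS; apply: eq_in_imset => x /(subsetP sS)/gX.
have [||h [ph _ _]] := @greedy_extension T e e_sym e_irr N (Q :|: A :|: B :|: M) L g
    (fun=> setT) (fun x => #|N[x]|) pg.
- by rewrite -setI_eq0 !setIUl !setU_eq0 !setI_eq0 dQL dAL dBL disjoint_sym dLM.
- move=> Y' v sY' vY' min_v; have vL := subsetP sY' v vY'.
  have domK := nbhd_sub_min L_nested (subsetP sY') vY' min_v.
  have leK : #|Y' :&: N[v]| <= #|K v|.
    apply: subset_leq_card; apply/subsetP=> x xY; have [xY' xv] := setIP xY.
    by rewrite /K vL inE (subsetP sY') // xv domK.
  pose Av := A :&: N[v].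
  have demand : #|Av| + #|B| + #|K v| - N <= #|Av :&: R'|.
    by have := dR' v; rewrite /dA /FA vL.
  have := cardsID R' Av => card_Av.
  (* Of the coloured vertices [v] sees only some in [A] and [B], and the colours of [R'] occur on
     [B]. *)
  have forbidden : #|g @: ((Q :|: A :|: B :|: M) :&: N[v])| <= #|B| + #|Av :\: R'|.
    apply: (@leq_trans #|g @: B :|: g @: (Av :\: R')|).
      apply: subset_leq_card; apply/subsetP=> _ /imsetP[x /setIP[xX xv] ->].
      case/setUP: xX => [/setUP[/setUP[xQ|xA]|xB]|xM].
      - have := adjX _ _ _ _ dQL xQ vL; rewrite closed_nbhdC // => /(_ xv).
        by rewrite (negbTE (QL xQ vL)).
      - have [xR'|xR'] := boolP (x \in R'); last first.
          have gx : g x \in g @: (Av :\: R') by apply: imset_f; rewrite in_setD xR' in_setI xA.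
          by rewrite in_setU gx orbT.
        rewrite in_setU fg_im ?subsetUr // gX ?(subsetP fR') ?imset_f //.
        by rewrite !inE xA orbT.
      - by rewrite in_setU imset_f.
      - by have := adjX _ _ _ _ dLM vL xM xv; rewrite (negbTE (LM vL xM)).
    apply: leq_trans (leq_card_setU _ _).1 _.
    by apply: leq_add; apply: leq_imset_card.
  rewrite cardsD setTI cardsT card_ord leq_subRL.
    apply: leq_trans (leq_add forbidden leK) _.
    have := B_K_leq v.
    move: demand card_Av; rewrite /N; clear; lia.
  by rewrite -[X in _ <= X]card_ord max_card.
apply: chi_leq (h) _; rewrite -cover -!setUA [L :|: M]setUC !setUA.
exact: ph.
Qed.
End BoilerColoring.

(** * Nested neighbourhoods from forbidden [C4] and [P4] *)

Section InducedSubgraphs.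
Variables (T : finType) (e : rel T).
Hypotheses (e_sym : symmetric e) (e_irr : irreflexive e).
Local Notation "N[ v ]" := (closed_nbhd e v).

Lemma C4_free (x y z t : T) : free e C4 -> e x y -> e y z -> e z t -> e t x ->
  x != z -> y != t -> ~~ e x z -> ~~ e y t -> False.
Proof.
move=> C4f xy yz zt tx nxz nyt xz yt.
have ne u v : e u v -> (u == v) = false by move=> uv; apply: contraTF uv => /eqP->; rewrite e_irr.
apply: C4f; exists (fun i : 'I_4 => nth x [:: x; y; z; t] i); split=> //.
- have u : uniq [:: x; y; z; t].
    by rewrite /= !inE !negb_or (ne _ _ xy) (ne _ _ yz) (ne _ _ zt) nxz nyt (eq_sym x t) (ne _ _ tx).
  by move=> i j /eqP; rewrite nth_uniq // => /eqP/val_inj.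
- case=> [[|[|[|[|//]]]] ?]; case=> [[|[|[|[|//]]]] ?] //=;
  by rewrite /cycle_rel /path_rel /= ?e_irr ?xy ?yz ?zt ?tx ?(negbTE xz) ?(negbTE yt) //
     e_sym ?xy ?yz ?zt ?tx ?(negbTE xz) ?(negbTE yt).
Qed.

Lemma P4_free (X : {set T}) (x y z t : T) : free_in e P4 X ->
  x \in X -> y \in X -> z \in X -> t \in X -> e x y -> e y z -> e z t ->
  x != t -> ~~ e x z -> ~~ e y t -> ~~ e x t -> False.
Proof.
move=> P4f xX yX zX tX xy yz zt nxt xz yt xt.
have ne u v : e u v -> (u == v) = false by move=> uv; apply: contraTF uv => /eqP->; rewrite e_irr.
apply: P4f; exists (fun i : 'I_4 => nth x [:: x; y; z; t] i); split=> //.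
- have nxz : x != z by apply: contraNneq xt => ->.
  have nyt : y != t by apply: contraNneq xt => <-.
  have u : uniq [:: x; y; z; t].
    by rewrite /= !inE !negb_or (ne _ _ xy) (ne _ _ yz) (ne _ _ zt) nxz nyt nxt.
  by move=> i j /eqP; rewrite nth_uniq // => /eqP/val_inj.
- by case=> [[|[|[|[|//]]]] ?].
- case=> [[|[|[|[|//]]]] ?]; case=> [[|[|[|[|//]]]] ?] //=;
  by rewrite /path_rel /= ?e_irr ?xy ?yz ?zt ?(negbTE xz) ?(negbTE yt) ?(negbTE xt) //
     e_sym ?xy ?yz ?zt ?(negbTE xz) ?(negbTE yt) ?(negbTE xt).
Qed.

Hypothesis C4f : free e C4.

(** Private neighbours [b] of [a] and [b'] of [a'] would close the induced four-cycle
    [a a' b' b]. *)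
Lemma clique_nbhd_chain (A B : {set T}) a a' : [disjoint A & B] ->
  is_clique e A -> is_clique e B -> a \in A -> a' \in A ->
  B :&: N[a] \subset N[a'] \/ B :&: N[a'] \subset N[a].
Proof.
move=> dAB /is_cliqueP cA /is_cliqueP cB aA a'A.
have adj u v : u != v -> v \in N[u] -> e u v.
  by rewrite eq_sym inE => /negbTE->.
have AB_adj u b : u \in A -> b \in B -> b \in N[u] -> e u b.
  by move=> uA bB; apply: adj; apply: contraTneq uA => ->; rewrite (disjointFl dAB bB).
apply/orP/contraT; rewrite negb_or => /andP[].
case/subsetPn=> b /setIP[bB ba] ba'; case/subsetPn=> b' /setIP[b'B b'a'] b'a.
have bb' : b != b' by apply: contraNneq ba' => ->.
have aa' : a != a' by apply: contraNneq ba' => <-.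
have ab := AB_adj a b aA bB ba; have a'b' := AB_adj a' b' a'A b'B b'a'.
case: (@C4_free a a' b' b) => //.
- exact: adj aa' (cA _ _ aA a'A).
- by rewrite e_sym; apply: adj bb' (cB _ _ bB b'B).
- by rewrite e_sym.
- by apply: contraTneq aA => ->; rewrite (disjointFl dAB b'B).
- by apply: contraTneq a'A => ->; rewrite (disjointFl dAB bB).
- by move: b'a; rewrite inE negb_or => /andP[].
- by move: ba'; rewrite inE negb_or => /andP[].
Qed.

Variables X Y : {set T}.
Hypotheses (dXY : [disjoint X & Y]) (cY : is_clique e Y).
Hypothesis P4f : free_in e P4 X.
Hypothesis nbr : forall x, x \in X -> exists2 y, y \in Y & e x y.
Hypothesis private : forall x x' y, x \in X -> x' \in X -> y \in Y ->
  e x y -> e x' y -> x' \in N[x].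

(** By [private], the non-adjacent [p] and [x'] share no neighbour in [Y]. A neighbour of [x] in [Y]
    is also one of [x'], else it closes a [C4] with [x], [x'], [q]. So a neighbour [z] of [p] and a
    neighbour [y] of [x] in [Y] give the induced cycle [x p z y]. *)
Lemma plume_no_crossing x x' p q : x \in X -> x' \in X -> p \in X -> q \in Y ->
  e x x' -> e x p -> e x' q -> p != x' -> ~~ e p x' -> ~~ e q x -> False.
Proof.
move=> xX x'X pX qY xx' xp x'q npx' px' qx.
have Y_adj y y' : y \in Y -> y' \in Y -> y != y' -> e y y'.
  move=> yY y'Y; have /is_cliqueP/(_ y y' yY y'Y) := cY.
  by rewrite inE eq_sym => /orP[->|].
have XY_neq u y : u \in X -> y \in Y -> u != y.
  by move=> uX yY; apply: contraTneq uX => ->; rewrite (disjointFl dXY yY).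
have not_px' y : y \in Y -> e p y -> ~~ e x' y.
  move=> yY py; apply/negP=> x'y; have := private pX x'X yY py x'y.
  by rewrite inE eq_sym (negbTE npx') (negbTE px').
have x_to_x' y : y \in Y -> e x y -> e x' y.
  move=> yY xy; apply: contraT => x'y; case: (@C4_free x x' q y) => //.
  - by rewrite Y_adj //; apply: contraNneq qx => ->; rewrite e_sym.
  - by rewrite e_sym.
  - exact: XY_neq.
  - exact: XY_neq.
  - by rewrite e_sym.
have [z zY pz] := nbr pX; have [y yY xy] := nbr xX.
have x'y := x_to_x' y yY xy.
have py : ~~ e p y by apply: contraL x'y; apply: not_px'.
have xz : ~~ e x z.
  by apply/negP=> /(x_to_x' z zY); apply/negP; apply: not_px'.
case: (@C4_free x p z y) => //.
- by apply: Y_adj => //; apply: contraNneq py => <-.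
- by rewrite e_sym.
- exact: XY_neq.
- exact: XY_neq.
Qed.

(** Let [p] and [q] witness that neither inclusion holds. If adjacent, they form a [C4] with [x] and
    [x']; if not, they give a [P4] within [X], a crossing excluded by [plume_no_crossing], or two
    non-adjacent vertices of the clique [Y]. *)
Lemma plume_nested x x' : x \in X -> x' \in X -> x' \in N[x] ->
  (X :|: Y) :&: N[x] \subset N[x'] \/ (X :|: Y) :&: N[x'] \subset N[x].
Proof.
move=> xX x'X; rewrite inE => /orP[/eqP->|xx']; first by left; apply: subsetIr.
apply/orP/contraT; rewrite negb_or => /andP[].
case/subsetPn=> p /setIP[pXY px] px'; case/subsetPn=> q /setIP[qXY qx'] qx.
have {px} xp : e x p.
  move: px px'; rewrite !inE negb_or => /orP[/eqP->|//].
  by rewrite e_sym xx' andbF.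
have {qx'} x'q : e x' q.
  move: qx' qx; rewrite !inE negb_or => /orP[/eqP->|//].
  by rewrite xx' andbF.
move: px' qx; rewrite !inE !negb_or => /andP[npx' px'] /andP[nqx qx].
have npq : p != q by apply: contraNneq px' => ->.
have [pq|pq] := boolP (e p q).
  case: (@C4_free p x x' q) => //; rewrite 1?e_sym //.
  by rewrite eq_sym.
case/setUP: pXY => pS; case/setUP: qXY => qS.
- case: (P4_free P4f pS xX x'X qS) => //; rewrite 1?e_sym //.
- by case: (plume_no_crossing xX x'X pS qS) => //; rewrite e_sym.
- by case: (plume_no_crossing x'X xX qS pS) => //; rewrite e_sym.
- have /is_cliqueP/(_ p q pS qS) := cY.
  by rewrite inE eq_sym (negbTE npq) (negbTE pq).
Qed.
End InducedSubgraphs.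

(** * Privacy and nestedness in a boiler *)

Theorem theorem5p16 (T : finType) (e : rel T)
  (e_sym : symmetric e) (e_irr : irreflexive e) :
  boiler e -> chi e <= (5 * omega e + 3) %/ 4.
Proof.
move=> [Q [A [B [L [M [k [Ms [Bs]]]]]]]].
move=> [[_ C4f _]] [[cover [dQA dQB dQL dQM] [dAB dAL dAM] [dBL dBM dLM]]].
move=> [[Q0 _ _ _]] [[cQ cA cB]] [[QA QM BL]] [[QB QL LM]] [[P4L _ P4M _]] [L_nbr].
move=> [[k3 [defM [defB _]] anti M_nbr _] [A01 A_hom A_Bnon]].
have Mi m : m \in M -> exists2 i, i < k & m \in Ms i.
  by rewrite defM => /bigcupP[i _ mi]; exists i.
have M_sub i m : i < k -> m \in Ms i -> m \in M.
  by move=> ik mi; rewrite defM; apply/bigcupP; exists (Ordinal ik).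
have B_sub i b : i < k -> b \in Bs i -> b \in B.
  by move=> ik bi; rewrite defB; apply/bigcupP; exists (Ordinal ik).
have homog i a u v : i < k -> a \in A -> u \in Ms i :|: Bs i -> v \in Ms i :|: Bs i ->
    e a u = e a v.
  move=> ik aA ui vi.
  have [i2|i2] := ltnP i 2.
    have in01 x : x \in Ms i :|: Bs i -> x \in Ms 0 :|: Bs 0 :|: Ms 1 :|: Bs 1.
      by case: i i2 {ik ui vi} => [|[|//]] _; rewrite !in_setU => /orP[] ->; rewrite ?orbT.
    by rewrite !A01 ?in01.
  have [|cAi|cAi] := A_hom i a _ aA; first by rewrite i2.
    by rewrite !cAi ?set11.
  by rewrite !(negbTE (cAi _ _ (set11 a) _)).
have M_B_index i m b : i < k -> m \in Ms i -> b \in B -> e m b -> b \in Bs i.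
  move=> ik mi bB; apply: contraTT => bi; have [_ far] := M_nbr i m ik mi.
  by apply: far; rewrite in_setD bi.
have M_M_index i m m' : i < k -> m \in Ms i -> m' \in M -> e m m' -> m' \in Ms i.
  move=> ik mi /Mi[j jk m'j]; have [->//|nij] := eqVneq i j.
  by have [_ _ /(_ m m' mi m'j)/negbTE->] := anti i j ik jk nij.
have [q qQ] := set0Pn _ Q0.
(* Two vertices with two non-adjacent common neighbours must be adjacent, or a [C4] appears. *)
have private_of (x x' y y' : T) : x != x' -> y != y' -> ~~ e y y' ->
    e x y -> e x' y -> e x y' -> e x' y' -> x' \in closed_nbhd e x.
  move=> nxx' nyy' yy' xy x'y xy' x'y'; rewrite inE eq_sym (negbTE nxx') /=.
  apply: contraT => xx'; case: (C4_free e_sym e_irr C4f xy _ x'y' _ nxx' nyy' xx' yy').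
    by rewrite e_sym.
  by rewrite e_sym.
have self (x : T) : x \in closed_nbhd e x by rewrite inE eqxx.
have M_private m m' b : m \in M -> m' \in M -> b \in B -> e m b -> e m' b ->
    m' \in closed_nbhd e m.
  move=> mM m'M bB mb m'b; have [->|nmm'] := eqVneq m m'; first exact: self.
  (* The second common neighbour is [q]: [Q] is complete to [M] and anticomplete to [B]. *)
  apply: (private_of m m' b q) => //; last 2 first.
  - by rewrite e_sym QM.
  - by rewrite e_sym QM.
  - by apply: contraTneq bB => ->; rewrite (disjointFr dQB qQ).
  - by rewrite e_sym QB.
have L_private l l' a : l \in L -> l' \in L -> a \in A -> e l a -> e l' a ->
    l' \in closed_nbhd e l.
  move=> lL l'L aA la l'a; have [->|nll'] := eqVneq l l'; first exact: self.
  (* Here the second common neighbour is a vertex of [B] missed by [a]; it exists since [a] is not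
     complete to [B]. *)
  have [/exists_inP[b bB ab]|no] := boolP [exists b in B, ~~ e a b].
    apply: (private_of l l' a b) => //; last 2 first.
    - by rewrite e_sym BL.
    - by rewrite e_sym BL.
    - by apply: contraTneq aA => ->; rewrite (disjointFl dAB bB).
  case: (A_Bnon a aA) => x b /set1P-> bB; apply: contraT => ab.
  by case/negP: no; apply/exists_inP; exists b.
have M_nested m m' : m \in M -> m' \in M -> m' \in closed_nbhd e m ->
    closed_nbhd e m \subset closed_nbhd e m' \/ closed_nbhd e m' \subset closed_nbhd e m.
  move=> mM m'M mm'.
  have nbr x : x \in M -> exists2 b, b \in B & e x b.
    by case/Mi=> i ik xi; have [[b bi xb] _] := M_nbr i x ik xi; exists b => //; apply: B_sub bi.
  (* Only [M] and [B] need checking: [Q] is complete to [M], [L] is anticomplete to it, and by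
     [homog] a vertex of [A] does not distinguish [x] from [x'], which lie in the same [Ms i]. *)
  have lift x x' : x \in M -> x' \in M -> x' \in closed_nbhd e x ->
      (M :|: B) :&: closed_nbhd e x \subset closed_nbhd e x' ->
      closed_nbhd e x \subset closed_nbhd e x'.
    move=> xM x'M xx' /subsetP s; apply/subsetP=> z zx.
    have [i ik xi] := Mi x xM.
    have x'i : x' \in Ms i.
      by move: xx'; rewrite inE => /orP[/eqP->//|]; apply: M_M_index.
    have : z \in [set: T] by [].
    rewrite -cover => /setUP[/setUP[/setUP[/setUP[zQ|zA]|zB]|zL]|zM].
    - by rewrite inE e_sym QM ?orbT.
    - move: zx; rewrite !inE => /orP[/eqP zx|xz].
        by rewrite zx (disjointFl dAM xM) in zA.
      by rewrite e_sym (homog i z x' x) ?in_setU ?x'i ?xi // e_sym xz orbT.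
    - by apply: s; rewrite in_setI zx in_setU zB orbT.
    - move: zx; rewrite !inE => /orP[/eqP zx|xz].
        by rewrite zx (disjointFl dLM xM) in zL.
      by have := LM z x zL xM; rewrite e_sym xz.
    - by apply: s; rewrite in_setI zx in_setU zM.
  have dMB : [disjoint M & B] by rewrite disjoint_sym.
  case: (plume_nested e_sym e_irr C4f dMB cB P4M nbr M_private mM m'M mm') => s.
    by left; apply: lift.
  by right; apply: lift; rewrite // closed_nbhdC.
have L_nested l l' : l \in L -> l' \in L -> l' \in closed_nbhd e l ->
    closed_nbhd e l \subset closed_nbhd e l' \/ closed_nbhd e l' \subset closed_nbhd e l.
  move=> lL l'L ll'.
  have lift x x' : x \in L -> x' \in L ->
      (L :|: A) :&: closed_nbhd e x \subset closed_nbhd e x' ->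
      closed_nbhd e x \subset closed_nbhd e x'.
    move=> xL x'L /subsetP s; apply/subsetP=> z zx.
    have : z \in [set: T] by [].
    rewrite -cover => /setUP[/setUP[/setUP[/setUP[zQ|zA]|zB]|zL]|zM].
    - move: zx; rewrite !inE => /orP[/eqP zx|xz].
        by rewrite zx (disjointFl dQL xL) in zQ.
      by have := QL z x zQ xL; rewrite e_sym xz.
    - by apply: s; rewrite in_setI zx in_setU zA orbT.
    - by rewrite inE e_sym BL ?orbT.
    - by apply: s; rewrite in_setI zx in_setU zL.
    - move: zx; rewrite !inE => /orP[/eqP zx|xz].
        by rewrite zx (disjointFr dLM xL) in zM.
      by have := LM x z xL zM; rewrite xz.
  have dLA : [disjoint L & A] by rewrite disjoint_sym.
  case: (plume_nested e_sym e_irr C4f dLA cA P4L L_nbr L_private lL l'L ll') => s.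
    by left; apply: lift.
  by right; apply: lift.
have AMB a m b : a \in A -> m \in M -> b \in B -> e m b -> e a m = e a b.
  move=> aA /Mi[i ik mi] bB mb; apply: (homog i) => //.
    by rewrite in_setU mi.
  by rewrite in_setU (M_B_index i m b) ?orbT.
have AB_chain a a' : a \in A -> a' \in A ->
    B :&: closed_nbhd e a \subset closed_nbhd e a' \/
    B :&: closed_nbhd e a' \subset closed_nbhd e a.
  exact: clique_nbhd_chain.
(* Both sides are the ceiling of five quarters of [omega e]. *)
rewrite (_ : (5 * omega e + 3) %/ 4 = omega e + (omega e + 3) %/ 4).
  exact: (@boiler_coloring T e e_sym e_irr Q A B L M).
by move: (omega e) => n; clear; lia.
Qed.
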